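(* For every $K>0$ there is a constant $C=C(K)>0$ such that the following holds. Let $A\subset\mathbb{R}$ be a finite set with $|A|\ge 2$. If $|(A-A)/(A-A)|\le K|A|^2$ or $|(A-A)(A-A)|\le K|A|^2$, then $$|A-A|\le C\,|A|^{2-\frac15}(\log|A|)^{\frac{3}{10}}.$$
   Context: For finite $X,Y\subset\mathbb{R}$: $X-Y=\{x-y: x\in X,\,y\in Y\}$, $XY=\{xy: x\in X,\,y\in Y\}$, $X/Y=\{x/y: x\in X,\,y\in Y,\,y\ne 0\}$. $|\cdot|$ denotes cardinality. Logarithms are to base $2$. *)

(* Defs.v *)
From mathcomp Require Import all_boot all_order all_algebra.
From mathcomp Require Import finmap.
From mathcomp Require Import all_classical all_reals all_analysis.

Set Implicit Arguments.
Unset Strict Implicit.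
Unset Printing Implicit Defensive.

Local Open Scope fset_scope.
Local Open Scope ring_scope.

Definition diffset (R : realType) (X Y : {fset R}) : {fset R} :=
  [fset x - y | x in X, y in Y].

Definition prodset (R : realType) (X Y : {fset R}) : {fset R} :=
  [fset x * y | x in X, y in Y].

Definition quotset (R : realType) (X Y : {fset R}) : {fset R} :=
  [fset x / y | x in X, y in [fset y in Y | y != 0]].

Definition log2 (R : realType) (x : R) : R := ln x / ln 2.

(* Main.v *)
(* Let D = A - A, E = D \ {0}, and let Q be the set of ratios (c - a) / (b - a)
   with a, b, c in A distinct.  Two triples with the same ratio give three
   collinear points of A x A, so the Szemeredi-Trotter bound for collinear
   triples and Cauchy-Schwarz give |A|^2 << |Q| log |A|.  Let S be E or E^-1,
   according to the hypothesis, so that |ES| <= K |A|^2.  Then QS is contained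
   in SS/S, and the Pluennecke-Ruzsa inequality gives |QS| |E|^2 <= |ES|^3.  As
   Q = 1 - Q, each of the |S|^2 lines X / u + Y / v = 1 with u, v in S has at
   least |Q| points in QS x QS, so Szemeredi-Trotter gives
   |E|^2 |Q|^3 << |QS|^4.  Together, |E|^10 << |A|^18 (log |A|)^3.

   For Cartesian products, Szemeredi-Trotter has a short proof: cut the product
   into a grid of blocks; a line meets few blocks, hence has many pairs of points
   in a common block, and each such pair lies on one line only. *)
Require Import Defs.
From mathcomp Require Import all_boot all_order all_algebra.
From mathcomp Require Import finmap.
From mathcomp Require Import all_classical all_reals all_analysis.
From mathcomp Require Import zify ring lra.

Set Implicit Arguments.
Unset Strict Implicit.
Unset Printing Implicit Defensive.

Import Order.TTheory GRing.Theory Num.Theory.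

Local Open Scope fset_scope.
Local Open Scope ring_scope.

(** * A Szemeredi-Trotter bound for monotone chains in a square grid *)

Section Grid.
Local Open Scope nat_scope.

Lemma sum_sqr_leq (I : finType) (F : I -> nat) :
  (\sum_i F i) ^ 2 <= #|I| * \sum_i F i ^ 2.
Proof.
rewrite -(leq_pmul2l (isT : 0 < 2)) -mulnn big_distrlr /= big_distrr /=.
have -> : 2 * (#|I| * \sum_i F i ^ 2) = \sum_i \sum_k (F i ^ 2 + F k ^ 2).
  under [RHS]eq_bigr => i _ do rewrite big_split /= sum_nat_const.
  rewrite big_split /= sum_nat_const -big_distrr /=. by rewrite -mulnDr addnn -mul2n mulnCA.
apply: leq_sum => i _; rewrite big_distrr; apply: leq_sum => k _ /=.
exact: nat_Cauchy.
Qed.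

(** Cauchy-Schwarz for the fibre sizes of [f] on [A], whose squares count the pairs in a common
    fibre. *)
Lemma card_collisions (T U : finType) (f : T -> U) (A : {set T}) :
  #|A| ^ 2 <= #|U| * #|[set p in finset.setX A A | f p.1 == f p.2]|.
Proof.
have -> : #|A| = \sum_u #|[set x in A | f x == u]|.
  rewrite -sum1_card (partition_big f predT) //=.
  by apply: eq_bigr => u _; rewrite -sum1_card; apply: eq_bigl => x; rewrite inE.
apply: leq_trans (sum_sqr_leq _) _; rewrite leq_mul2l; apply/orP; right.
rewrite -[leqRHS]sum1_card (partition_big (fun p => f p.1) predT) //=.
apply: leq_sum => u _; rewrite -mulnn -cardsX -sum1_card.
rewrite [leqRHS](bigID (fun p => p \in finset.setX [set x in A | f x == u] [set x in A | f x == u])) /=.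
apply: leq_trans (leq_addr _ _); apply: eq_leq; apply: eq_bigl => p; rewrite !inE.
by case: (f p.1 =P u) => [->|_]; rewrite ?andbT ?andbF //= (eq_sym u);
  do 2 case: (_ \in A) => //=; rewrite ?andbF ?andbb.
Qed.

Section RichChains.
Variables (T : finType) (rk : T -> nat).
Hypothesis rk_inj : injective rk.

Lemma card_block m c : 0 < m -> #|[set y | rk y %/ m == c]| <= m.
Proof.
move=> m0; rewrite -[leqRHS]card_ord.
pose g y := Ordinal (ltn_pmod (rk y) m0).
have /finset.card_in_imset <- : {in [set y | rk y %/ m == c] &, injective g}.
  move=> x y; rewrite !inE => /eqP hx /eqP hy /(congr1 val) /= h.
  by apply: rk_inj; rewrite (divn_eq (rk x) m) (divn_eq (rk y) m) hx hy h.
exact: max_card.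
Qed.

Let cell m (p : T * T) := (rk p.1 %/ m, rk p.2 %/ m).

(** A cell is a product of two blocks, so each point shares its cell with at most [m ^ 2] points. *)
Lemma card_same_cell m : 0 < m ->
  #|[set d : (T * T) * (T * T) | cell m d.1 == cell m d.2]| <= (#|T| * m) ^ 2.
Proof.
move=> m0; rewrite -sum1_card.
rewrite (partition_big (fun d => d.1) predT) //=.
apply: (@leq_trans (\sum_(p : T * T) m ^ 2)); last first.
  by rewrite sum_nat_const (card_prod T T) expnMn mulnn.
apply: leq_sum => p _; rewrite sum1_card.
rewrite -[leqRHS]mulnn.
apply: leq_trans (leq_mul (card_block (rk p.1 %/ m) m0) (card_block (rk p.2 %/ m) m0)).
rewrite -cardsX.
have inj : {in [pred d | (d \in [set d | cell m d.1 == cell m d.2]) && (d.1 == p)] &,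
     injective (fun d : (T*T)*(T*T) => d.2)}.
  by move=> [x y] [x' y'] /andP[_ /eqP /= ->] /andP[_ /eqP /= ->] ->.
rewrite -(fintype.card_in_image inj);
  apply/subset_leq_card/fintype.subsetP => q /fintype.imageP[[x y]].
by rewrite !inE /= => /andP[/eqP[h1 h2] /eqP xp] ->; rewrite -xp h1 h2 !eqxx.
Qed.

(** Combinatorial substitute for a non-vertical line. Equal first ranks satisfy the premise in both
    directions, so a chain is the graph of a monotone partial function. *)
Definition chain (C : {set T * T}) :=
  {in C &, forall p q, rk p.1 <= rk q.1 -> rk p.2 <= rk q.2} \/
  {in C &, forall p q, rk p.1 <= rk q.1 -> rk q.2 <= rk p.2}.

(* A chain crosses few cells: [block of x +/- block of y] determines the cell. *)
Lemma chain_collisions (C : {set T * T}) m h : 0 < m ->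
  (forall x, rk x < m * h.+1) -> chain C ->
  #|C| ^ 2 <= h.*2.+1 * #|[set d in finset.setX C C | cell m d.1 == cell m d.2]|.
Proof.
move=> m0 hm hC.
have hb x : rk x %/ m <= h by rewrite -ltnS ltn_divLR // mulnC.
suff [f hf] : exists f : T * T -> 'I_h.*2.+1,
    {in C &, forall p q, f p = f q -> cell m p = cell m q}.
  apply: leq_trans (card_collisions f C) _; rewrite card_ord leq_mul2l /=.
  apply/subset_leq_card/fintype.subsetP => -[p q]; rewrite !inE /= => /andP[/andP[pC qC] /eqP/hf].
  by move=> ->; rewrite ?pC ?qC //=.
case: hC => hC.
  have h1 p : rk p.1 %/ m + rk p.2 %/ m < h.*2.+1.
    by rewrite ltnS -addnn leq_add.
  exists (fun p => Ordinal (h1 p)) => p q pC qC /(congr1 val) /=.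
  wlog pq : p q pC qC / rk p.1 <= rk q.1.
    by move=> H; case/orP: (leq_total (rk p.1) (rk q.1)) => /H {}H e; [|symmetry]; exact: H.
  (* Both block indices are weakly increasing along the chain, so equal sums force equal indices. *)
  have := leq_div2r m pq; have := leq_div2r m (hC _ _ pC qC pq).
  by rewrite /cell => ? ? ?; congr pair; lia.
(* On a decreasing chain the second block index is reversed, which keeps the label a natural
   number. *)
have h1 p : rk p.1 %/ m + (h - rk p.2 %/ m) < h.*2.+1.
  by rewrite ltnS -addnn leq_add // leq_subr.
exists (fun p => Ordinal (h1 p)) => p q pC qC /(congr1 val) /=.
wlog pq : p q pC qC / rk p.1 <= rk q.1.
  by move=> H; case/orP: (leq_total (rk p.1) (rk q.1)) => /H {}H e; [|symmetry]; exact: H.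
have := leq_div2r m pq; have := leq_div2r m (hC _ _ pC qC pq).
by have := hb q.2; have := hb p.2; rewrite /cell => ? ? ? ? ?; congr pair; lia.
Qed.

Lemma card_chain (C : {set T * T}) : chain C -> #|C| <= #|T|.
Proof.
move=> hC; have inj : {in C &, injective (fun p : T * T => p.1)}.
  move=> [x y] [x' y'] pC qC /= e; move: qC; rewrite -e => qC; congr pair.
  apply: rk_inj; apply/eqP; rewrite eqn_leq.
  by case: hC => h; rewrite (h _ _ pC qC) // (h _ _ qC pC).
rewrite -(finset.card_in_imset inj); exact: max_card.
Qed.

(* The Szemeredi-Trotter bound, with chains in place of lines: there are about
   [j / 4] blocks of [m] consecutive ranks in each direction. *)
Lemma rich_chains (I : finType) (P : pred I) (C : I -> {set T * T}) j :
  (forall x, rk x < #|T|) -> 1 < j ->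
  (forall i, P i -> chain (C i)) ->
  (forall i, P i -> j <= #|C i|) ->
  (forall i i' p q, P i -> P i' -> p \in C i -> q \in C i -> p \in C i' ->
     q \in C i' -> p != q -> i = i') ->
  j * \sum_(i | P i) #|C i| ^ 2 <= 36 * #|T| ^ 4.
Proof.
move=> rkT j1 chC jC interC.
case: (pickP P) => [i0 Pi0|P0]; last by rewrite big_pred0 ?muln0.
have jT : j <= #|T| := leq_trans (jC _ Pi0) (card_chain (chC _ Pi0)).
pose h := (j - 2) %/ 4; pose m := (#|T|.-1 %/ h.+1).+1.
have hm x : rk x < m * h.+1.
  apply: (@leq_trans #|T|) => //.
  have := ltn_ceil #|T|.-1 (ltn0Sn h); rewrite -/m; lia.
(* The value of [h] is a compromise: small enough that diagonal pairs can be absorbed, large enough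
   that [m] is of order [#|T| / j]. *)
have qj : 2 * h.*2.+1 <= j by rewrite /h; lia.
have jm : j * m <= 6 * #|T|.
  have e1 : j <= 5 * h.+1 by rewrite /h; lia.
  have e2 : #|T|.-1 %/ h.+1 * h.+1 <= #|T|.-1 := leq_divM _ _.
  by rewrite /m mulnS; nia.
pose D i := [set d in finset.setX (C i) (C i) | (cell m d.1 == cell m d.2) && (d.1 != d.2)].
(* Twice [chain_collisions] gives [2 * #|C i| ^ 2 <= j * (#|D i| + #|C i|)]; the diagonal part
   [j * #|C i|] is at most [#|C i| ^ 2], as [C i] is rich. *)
have kD i : P i -> #|C i| ^ 2 <= j * #|D i|.
  move=> Pi; have := chain_collisions (ltn0Sn _) hm (chC _ Pi); rewrite -/m.
  rewrite -(cardsID [set d | d.1 != d.2]).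
  have -> : [set d in finset.setX (C i) (C i) | cell m d.1 == cell m d.2] :&: [set d | d.1 != d.2] = D i.
    by apply/finset.setP => d; rewrite !inE andbA.
  have : #|[set d in finset.setX (C i) (C i) | cell m d.1 == cell m d.2] :\: [set d | d.1 != d.2]| <= #|C i|.
    have /finset.card_imset <- : injective (fun p : T * T => (p, p)) by move=> ? ? [].
    apply/subset_leq_card/fintype.subsetP => -[p q]; rewrite !inE /= negbK => /andP[/eqP <-].
    by case/andP=> /andP[pC _] _; apply: finset.imset_f.
  move=> xk kq; rewrite -(leq_add2l (#|C i| ^ 2)) addnn -mul2n.
  apply: (@leq_trans (2 * (h.*2.+1 * (#|D i| + #|C i|)))).
    by rewrite leq_mul2l (leq_trans kq) // leq_mul2l leq_add2l xk.
  rewrite mulnA (leq_trans (leq_mul qj (leqnn _))) // mulnDr addnC leq_add2r.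
  by rewrite -mulnn leq_mul2r jC ?orbT.
apply: (@leq_trans (j * (j * (#|T| * m) ^ 2))); last first.
  rewrite mulnA mulnn -expnMn mulnCA -[36]/(6 ^ 2) [leqRHS](_ : _ = (#|T| * (6 * #|T|)) ^ 2).
    by rewrite leq_exp2r // leq_mul2l jm orbT.
  by rewrite !expnMn mulnCA -expnD.
rewrite leq_mul2l; apply/orP; right.
apply: (@leq_trans (\sum_(i | P i) j * #|D i|)); first exact: leq_sum.
rewrite -big_distrr leq_mul2l /=; apply/orP; right.
apply: leq_trans (card_same_cell (ltn0Sn _)); rewrite -/m.
under eq_bigr => i _ do rewrite -sum1_card.
(* Double counting: a pair of distinct points lies on at most one chain, so it is counted at most
   once. *)
rewrite (exchange_big_dep predT) //=.
rewrite -sum1_card [leqRHS]big_mkcond /=; apply: leq_sum => -[p q] _.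
rewrite inE /=; case: ifPn => [hc|/negPf hc]; last first.
  by rewrite big_pred0 // => i; rewrite !inE /= hc andbF andbF.
case: (pickP (fun i => P i && ((p, q) \in D i))) => [i /andP[Pi pi]|?]; last by rewrite big_pred0.
rewrite (big_pred1 i) // => i' /=; apply/idP/eqP => [/andP[Pi' pi']|->]; last by rewrite Pi pi.
move: pi pi'; rewrite !inE /= => /andP[/andP[pi qi] /andP[_ npq]] /andP[/andP[pi' qi'] _].
exact: (interC _ _ p q).
Qed.
End RichChains.
End Grid.

(** * Rich lines and collinear triples in a Cartesian product *)

Section Lines.
Variables (R : realFieldType) (B : {fset R}).

(** With ranks, blocks of consecutive elements of [B] become classes of integer division. *)
Definition fset_rank (x : B) : nat := #|[set y : B | val y < val x]|.

Lemma fset_rank_mono : {mono fset_rank : x y / val x <= val y >-> (x <= y)%N}.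
Proof.
move=> x y; apply/idP/idP => [|xy]; last first.
  apply/subset_leq_card/fintype.subsetP => z; rewrite !inE => zx.
  exact: lt_le_trans zx xy.
rewrite leqNgt; apply: contraNT; rewrite -ltNge => yx.
apply/proper_card/properP; split.
  by apply/fintype.subsetP => z; rewrite !inE => /lt_trans; apply.
by exists y; rewrite !inE // ltxx.
Qed.

Lemma fset_rank_inj : injective fset_rank.
Proof.
move=> x y e; apply/val_inj/eqP; rewrite eq_le.
by rewrite -!fset_rank_mono e leqnn.
Qed.

Lemma fset_rank_lt x : (fset_rank x < #|{: B}|)%N.
Proof.
rewrite -cardsT; apply/proper_card/properP; split; first exact: finset.subsetT.
by exists x; rewrite !inE // ltxx.
Qed.

(* The pair [l] encodes the line [y = l.1 * x + l.2]. *)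
Definition line_pts (l : R * R) : {set B * B} :=
  [set p : B * B | val p.2 == l.1 * val p.1 + l.2].

Lemma chain_line_pts l : chain fset_rank (line_pts l).
Proof.
have [l0|/ltW l0] := leP 0 l.1; [left|right] => p q; rewrite !inE => /eqP hp /eqP hq;
  rewrite !fset_rank_mono hp hq lerD2r => pq; nra.
Qed.

Lemma line_pts_inter l l' p q : l.1 != 0 ->
  p \in line_pts l -> q \in line_pts l -> p \in line_pts l' -> q \in line_pts l' ->
  p != q -> l = l'.
Proof.
case: l l' p q => [m c] [m' c'] [x y] [x' y'] /= m0; rewrite !inE /=.
move=> /eqP e1 /eqP e2 /eqP e3 /eqP e4 npq.
have nx : val x - val x' != 0.
  apply: contra npq; rewrite subr_eq0 => /eqP e; apply/eqP; congr pair.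
    exact: val_inj.
  by apply: val_inj; rewrite /= e1 e2 e.
have em : m = m'.
  apply/eqP; rewrite -subr_eq0 -(mulIr_eq0 _ (mulIf nx)); apply/eqP => /=; lra.
by congr pair; [|rewrite em in e1]; lra.
Qed.

Lemma rich_lines (I : finType) (P : pred I) (l : I -> R * R) j :
  (1 < j)%N -> {in P &, injective l} -> (forall i, P i -> (l i).1 != 0) ->
  (forall i, P i -> (j <= #|line_pts (l i)|)%N) ->
  (j * \sum_(i | P i) #|line_pts (l i)| ^ 2 <= 36 * #|` B| ^ 4)%N.
Proof.
move=> j1 linj l0 lj; rewrite cardfE.
apply: (rich_chains fset_rank_inj) => //.
- exact: fset_rank_lt.
- by move=> i _; exact: chain_line_pts.
- move=> i i' p q Pi Pi' h1 h2 h3 h4 npq.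
  by apply: linj => //; apply: (line_pts_inter (l0 _ Pi) h1 h2 h3 h4 npq).
Qed.

Lemma sum_line_pts_cube (L : {fset R * R}) (P : pred L) :
  (forall l, P l -> (val l).1 != 0) ->
  (forall l, P l -> (1 < #|line_pts (val l)|)%N) ->
  \sum_(l | P l) (#|line_pts (val l)| ^ 3)%:R <=
    36 * #|` B|%:R ^+ 4 * \sum_(1 <= j < #|` B|.+1) j%:R^-1 :> R.
Proof.
move=> l0 l2.
have cardB l : (#|line_pts l| <= #|` B|)%N.
  by rewrite cardfE; exact: (card_chain fset_rank_inj (chain_line_pts _)).
have cube l : (#|line_pts l| ^ 3 =
    \sum_(1 <= j < #|` B|.+1 | j <= #|line_pts l|) #|line_pts l| ^ 2)%N.
  rewrite -[LHS](_ : \sum_(1 <= j < (#|line_pts l|).+1) #|line_pts l| ^ 2 = _)%N.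
    by rewrite (big_nat_widen _ _ (#|` B|.+1)) // ltnS.
  by rewrite sum_nat_const_nat subn1 -expnS.
rewrite -natr_sum.
under eq_bigr => l _ do rewrite cube.
rewrite (exchange_big_dep predT) //= natr_sum mulr_sumr.
rewrite big_nat [leRHS]big_nat; apply: ler_sum => j /andP[j1 _].
rewrite ler_pdivlMr ?ltr0n // -!natrM -natrX -natrM ler_nat mulnC.
(* [rich_lines] requires [1 < j]; for [j = 1] the threshold can be raised to 2, since all lines
   considered have two points. *)
apply: (@leq_trans (maxn 2 j * \sum_(l | P l && (maxn 2 j <= #|line_pts (val l)|)) #|line_pts (val l)| ^ 2)%N).
  apply: leq_mul; first exact: leq_maxr.
  apply: eq_leq; apply: eq_bigl => l; case Pl: (P l) => //=.
  by rewrite geq_max (l2 _ Pl).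
apply: rich_lines => [|l l' _ _ /val_inj //|l /andP[/l0]//|l /andP[]//].
by rewrite leq_maxl.
Qed.
End Lines.

(** * The set of ratios of triples: size and symmetries *)

Section Ratios.
Variables (R : realFieldType) (A : {fset R}).

Let triple := (A * A * A)%type.

Definition distinct_triples : {set triple} :=
  [set t | [&& t.1.1 != t.1.2, t.1.1 != t.2 & t.1.2 != t.2]].

Definition ratio (t : triple) : R := (val t.2 - val t.1.1) / (val t.1.2 - val t.1.1).

Definition ratios : {fset R} := [fset ratio t | t in distinct_triples].

Lemma ratiosP x : reflect
  (exists a b c, [/\ [/\ a \in A, b \in A & c \in A],
     [/\ a != b, a != c & b != c] & x = (c - a) / (b - a)])
  (x \in ratios).
Proof.
apply: (iffP (imfsetP _ _ _ _)) => [[[[a b] c]]|[a [b [c [[aA bA cA] [ab ac bc] ->]]]]].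
  rewrite !inE /= => /and3P[ab ac bc] ->.
  by exists (val a), (val b), (val c); split=> //; split; exact: valP.
by exists ([` aA], [` bA], [` cA]) => //; rewrite !inE /=; apply/and3P.
Qed.

Lemma card_distinct_triples :
  (#|` A| ^ 3 <= #|distinct_triples| + 3 * #|` A| ^ 2)%N.
Proof.
have -> : (#|` A| ^ 3 = #|{: triple}|)%N by rewrite !card_prod -cardfE; lia.
have inj (S : {set triple}) (f : triple -> A * A) : {in S &, injective f} ->
    (#|S| <= #|` A| ^ 2)%N.
  by move=> /card_in_imset <-; apply: leq_trans (max_card _) _; rewrite card_prod -cardfE mulnn.
rewrite -cardsT -(finset.setUCr distinct_triples).
apply: leq_trans (leq_card_setU _ _) _; rewrite leq_add2l.
have /subset_leq_card/leq_trans -> // : ~: distinct_triples \subset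
   ([set t : triple | t.1.1 == t.1.2] :|: [set t | t.1.1 == t.2]) :|: [set t | t.1.2 == t.2].
  apply/fintype.subsetP => t; rewrite !inE !negb_and !negbK orbA; exact.
apply: leq_trans (leq_card_setU _ _) _.
apply: leq_trans (leq_add (leq_card_setU _ _) (leqnn _)) _.
rewrite [leqRHS](_ : _ = #|` A| ^ 2 + #|` A| ^ 2 + #|` A| ^ 2)%N; last by lia.
rewrite !leq_add //; [apply: (inj _ (fun t => (t.1.1, t.2)))
  | apply: (inj _ fst) | apply: (inj _ fst)] => -[[a b] c] [[a' b'] c'];
  by rewrite !inE /= => /eqP <- /eqP <- [-> ->].
Qed.

(** Pairs of triples with equal ratio are many by Cauchy-Schwarz if there are few ratios, but each
    is a collinear triple in [A * A]. The constant is [4 ^ 2 * 36]. *)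
Lemma card_ratios : (3 < #|` A|)%N ->
  #|` A|%:R ^+ 2 <= 576 * #|` ratios|%:R * \sum_(1 <= j < #|` A|.+1) j%:R^-1 :> R.
Proof.
move=> A3; set H := (\sum_(_ <= _ < _) _).
have A0 : 0 < #|` A|%:R :> R by rewrite ltr0n; lia.
have tri : (#|` A| ^ 3 <= 4 * #|distinct_triples|)%N by have := card_distinct_triples; nia.
have [t0 t0D] : exists t, t \in distinct_triples by apply/card_gt0P; nia.
have t0R : ratio t0 \in ratios by apply/imfsetP; exists t0.
(* The default [t0R] can only be taken at degenerate triples. *)
pose f t : ratios := insubd [` t0R] (ratio t).
have fE t : t \in distinct_triples -> val (f t) = ratio t.
  by move=> tD; rewrite insubdK //; apply/imfsetP; exists t.
have := card_collisions f distinct_triples; rewrite -cardfE.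
set E := [set _ in _ | _] => cE.
(* For triples [(a, b, c)] and [(a', b', c')], the line through [(a, a')] and [(b, b')]; equality of
   the ratios puts [(c, c')] on it. *)
pose line (d : triple * triple) : R * R :=
  let m := (val d.2.1.2 - val d.2.1.1) / (val d.1.1.2 - val d.1.1.1) in
  (m, val d.2.1.1 - m * val d.1.1.1).
pose L := [fset line d | d in [set: triple * triple]].
have lineL d : line d \in L by apply/imfsetP; exists d; rewrite ?inE.
have lineE d : d \in E -> (line d).1 != 0 /\
    [/\ (d.1.1.1, d.2.1.1) \in line_pts A (line d),
        (d.1.1.2, d.2.1.2) \in line_pts A (line d) &
        (d.1.2, d.2.2) \in line_pts A (line d)].
  case: d => [[[a b] c] [[a' b'] c']].
  rewrite inE finset.in_setX => /andP[/andP[d1 d2] /eqP /(congr1 val)].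
  rewrite !fE //; move: d1 d2; rewrite !inE /line /ratio /= => /and3P[ab _ _] /and3P[ab' _ _].
  have {}ab : val b - val a != 0 by rewrite subr_eq0 eq_sym.
  have {}ab' : val b' - val a' != 0 by rewrite subr_eq0 eq_sym.
  move=> e; split; first by rewrite mulf_neq0 // invr_neq0.
  split; apply/eqP; rewrite /=; [by ring| by field|].
  have -> : val c' = val a' + (val c - val a) / (val b - val a) * (val b' - val a').
    by rewrite /= e /=; field.
  by rewrite /=; field.
pose P (l : L) := ((val l).1 != 0) && (1 < #|line_pts A (val l)|)%N.
have PE d : d \in E -> P [` lineL d].
  move=> dE; have [l0 [h1 h2 _]] := lineE _ dE; rewrite /P l0 /=.
  apply/card_gt1P; exists (d.1.1.1, d.2.1.1), (d.1.1.2, d.2.1.2); split=> //.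
  case: d dE {l0 h1 h2} => t t'; rewrite inE finset.in_setX => /andP[/andP[d1 _] _].
  by apply: contraTneq d1 => -[e _]; rewrite inE e eqxx.
have cL : (#|E| <= \sum_(l | P l) #|line_pts A (val l)| ^ 3)%N.
  rewrite -sum1_card (partition_big (fun d => [` lineL d]) P) //=.
  apply: leq_sum => l _.
  rewrite sum1_card expnS -mulnn -!cardsX.
  (* Regroups two triples of coordinates as three points of the line. *)
  pose g (d : triple * triple) :=
    ((d.1.1.1, d.2.1.1), ((d.1.1.2, d.2.1.2), (d.1.2, d.2.2))).
  have ginj : injective g by move=> [[[? ?] ?] [[? ?] ?]] [[[? ?] ?] [[? ?] ?]] [-> -> -> -> -> ->].
  rewrite -(fintype.card_image ginj); apply/subset_leq_card/fintype.subsetP => u /fintype.imageP[d].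
  rewrite inE => /andP[/lineE[_ [h1 h2 h3]] /eqP dl] ->.
  by rewrite !finset.in_setX -dl /= h1 h2 h3.
have cH : #|E|%:R <= 36 * #|` A|%:R ^+ 4 * H :> R.
  apply: (@le_trans _ _ (\sum_(l | P l) (#|line_pts A (val l)| ^ 3)%:R)).
    by rewrite -natr_sum ler_nat.
  by apply: sum_line_pts_cube => l /andP[].
rewrite -(ler_pM2r (exprn_gt0 4 A0)).
apply: (@le_trans _ _ ((4 * #|distinct_triples|)%:R ^+ 2)).
  by rewrite -exprD -[(2 + 4)%N]/(3 * 2)%N -!natrX ler_nat expnM leq_exp2r.
apply: (@le_trans _ _ (16 * (#|` ratios|%:R * #|E|%:R))).
  by rewrite -natrX expnMn natrM ler_wpM2l // -natrM ler_nat.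
have -> : 576 * #|` ratios|%:R * H * #|` A|%:R ^+ 4 =
  16 * (#|` ratios|%:R * (36 * #|` A|%:R ^+ 4 * H)) by ring.
by rewrite ler_wpM2l // ler_wpM2l.
Qed.

Lemma ratios_neq0 x : x \in ratios -> x != 0.
Proof.
by case/ratiosP => a [b [c [_ [ab ac _] ->]]]; rewrite mulf_neq0 ?invr_neq0 // subr_eq0 eq_sym.
Qed.

(** Exchanging [a] and [b] in the ratio replaces [x] by [1 - x]. *)
Lemma ratios_subr1 x : x \in ratios -> 1 - x \in ratios.
Proof.
case/ratiosP => a [b [c [[aA bA cA] [ab ac bc] ->]]]; apply/ratiosP.
exists b, a, c; split=> //; first by rewrite eq_sym.
by field; rewrite !subr_eq0 ab eq_sym ab.
Qed.

Lemma card_ratios_gt1 : (3 < #|` A|)%N -> (1 < #|` ratios|)%N.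
Proof.
move=> A3; have [t tD] : exists t, t \in distinct_triples.
  by apply/card_gt0P; have := card_distinct_triples; nia.
have tR : ratio t \in ratios by apply/imfsetP; exists t.
(* The involutions [x -> 1 - x] and [x -> x^-1] have no common fixed point. *)
have vR x : x \in ratios -> x^-1 \in ratios.
  case/ratiosP => a [b [c [[aA bA cA] [ab ac bc] ->]]]; apply/ratiosP.
  by exists a, c, b; split=> //; rewrite ?invf_div // [c == b]eq_sym.
rewrite ltnNge; apply/negP => R1.
have eqR x y : x \in ratios -> y \in ratios -> x = y.
  move=> xR yR; have : #|` [fset x; y]| = 1%N.
    apply/eqP; rewrite eqn_leq cardfs2 andbT -cardfs2 (leq_trans _ R1) //.
    by apply: fsubset_leq_card; apply/fsubsetP => z; rewrite in_fset2 => /orP[]/eqP->.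
  by rewrite cardfs2; case: (x =P y).
have h := ratios_neq0 tR.
have e1 := eqR _ _ tR (ratios_subr1 tR).
have := eqR _ _ tR (vR _ tR); set x := ratio t in h e1 * => e2.
have : x * x = 1 by rewrite {2}e2 divff.
have -> : x = 1 / 2 by lra.
lra.
Qed.
End Ratios.

(** * Pluennecke-Ruzsa inequalities for product sets *)

Section ProductSets.
Variable R : realType.
Implicit Types X Y Z S E C : {fset R}.

Lemma prodsetP X Y z :
  reflect (exists x y, [/\ x \in X, y \in Y & z = x * y]) (z \in prodset X Y).
Proof.
apply: (iffP (imfset2P _ _ _ _ _)) => [[x xX [y yY ->]]|[x [y [xX yY ->]]]].
  by exists x, y.
by exists x => //; exists y.
Qed.

Lemma quotsetP X Y z :
  reflect (exists x y, [/\ x \in X, y \in Y, y != 0 & z = x / y]) (z \in quotset X Y).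
Proof.
apply: (iffP (imfset2P _ _ _ _ _)) => [[x xX [y]]|[x [y [xX yY y0 ->]]]].
  by rewrite !inE => /andP[yY y0] ->; exists x, y.
by exists x => //; exists y => //; rewrite !inE yY.
Qed.

(* Petridis' lemma, by induction on [C]: the hypothesis says that [X] minimizes
   the ratio #|XS| / #|X| among its subsets. *)
Lemma card_prodset_petridis X S C : 0 \notin C ->
  (forall Z, Z `<=` X -> #|` prodset X S| * #|` Z| <= #|` prodset Z S| * #|` X|)%N ->
  (#|` prodset (prodset X S) C| * #|` X| <= #|` prodset X S| * #|` prodset X C|)%N.
Proof.
move=> C0 Xmin; elim/finSet_rect: C C0 => C IH C0.
have [->|[c cC]] := fset_0Vmem C.
  suff -> : prodset (prodset X S) fset0 = fset0 by rewrite cardfs0.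
  by apply/fsetP => z; rewrite inE; apply/negbTE/prodsetP => -[x [y []]].
pose C' := C `\ c.
have c0 : c != 0 by apply: contraNneq C0 => <-.
have {}IH := IH C' (fproperD1 cC).
have {}IH : (#|` prodset (prodset X S) C'| * #|` X| <=
    #|` prodset X S| * #|` prodset X C'|)%N.
  by apply: IH; rewrite !inE negb_and C0 orbT.
have cardc Y : #|` [fset x * c | x in Y]| = #|` Y| := card_imfset _ _ (mulIf c0).
(* The elements [x] for which adding [c] to [C'] creates no new product [x * s * c]. *)
pose Z := [fset x in X | [fset x * s * c | s in S] `<=` prodset (prodset X S) C'].
have ZX : Z `<=` X by apply/fsubsetP => x; rewrite !inE => /andP[].
(* Every new product is [c] times an element of [XS] outside [ZS]. *)
have le1 : (#|` prodset (prodset X S) C| + #|` prodset Z S| <=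
    #|` prodset (prodset X S) C'| + #|` prodset X S|)%N.
  have ZS : prodset Z S `<=` prodset X S.
    apply/fsubsetP => _ /prodsetP[x [s [xZ sS ->]]]; apply/prodsetP.
    by exists x, s; split=> //; exact: (fsubsetP ZX).
  rewrite addnC -leq_subRL ?fsubset_leq_card //; last first.
    by apply: leq_trans (fsubset_leq_card ZS) (leq_addl _ _).
  rewrite -addnBA ?fsubset_leq_card // -cardfsDS // -(cardc (_ `\` _)).
  apply: leq_trans (leq_card_fsetU _ _); apply: fsubset_leq_card.
  apply/fsubsetP => _ /prodsetP[xs [d [/prodsetP[x [s [xX sS ->]]] dC ->]]].
  rewrite inE; have [dc|dc] := eqVneq d c; last first.
    apply/orP; left; apply/prodsetP; exists (x * s), d; split=> //.
      by apply/prodsetP; exists x, s.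
    by rewrite !inE dc.
  rewrite dc; have [//|nC'/=] := boolP (_ \in prodset (prodset X S) C').
  apply/imfsetP; exists (x * s) => //.
  have xsXS : x * s \in prodset X S by apply/prodsetP; exists x, s.
  rewrite !inE xsXS andbT; apply: contra nC' => /prodsetP[z [s' [zZ s'S ->]]].
  move: zZ; rewrite !inE => /andP[_ /fsubsetP]; apply.
  by apply/imfsetP; exists s'.
(* The products [y * c] with [y] in [X] outside [Z] avoid [XC']: from [y * c = x * d] would follow
   [y * s * c = x * s * d] for all [s], hence [y] in [Z]. *)
have le2 : (#|` prodset X C'| + #|` X| <= #|` prodset X C| + #|` Z|)%N.
  rewrite [leqRHS]addnC -leq_subLR -addnBA ?fsubset_leq_card //.
  rewrite -cardfsDS // -(cardc (_ `\` _)).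
  rewrite -[leqLHS]subn0 -(cardfs0 R).
  have <- : prodset X C' `&` [fset x * c | x in X `\` Z] = fset0.
    apply/fsetP => z; rewrite !inE; apply/negbTE/negP => /andP[/prodsetP[x [d [xX dC' ->]]]].
    case/imfsetP => y /=; rewrite !inE => /andP[nyZ yX] e.
    move: nyZ; rewrite yX /= => /fsubsetP[] w /imfsetP[s /= sS ->].
    apply/prodsetP; exists (x * s), d; split=> //; first by apply/prodsetP; exists x, s.
    by rewrite mulrAC -e mulrAC.
  rewrite -cardfsU; apply: fsubset_leq_card.
  apply/fsubsetP => z; rewrite inE => /orP[/prodsetP[x [d [xX]]]|/imfsetP[x /=]].
    by rewrite !inE => /andP[_ dC] ->; apply/prodsetP; exists x, d.
  by rewrite inE => /andP[_ xX] ->; apply/prodsetP; exists x, c.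
have := Xmin _ ZX; have := fsubset_leq_card ZX; nia.
Qed.

(** Supplies the set for Petridis' lemma: a nonempty subset minimizing [#|XS| / #|X|]. Comparison
    with [E] itself gives the third clause. *)
Lemma exists_min_prodset_ratio E S : E != fset0 -> exists X, [/\ X `<=` E, X != fset0,
  (#|` prodset X S| * #|` E| <= #|` prodset E S| * #|` X|)%N &
  (forall Z, Z `<=` X -> #|` prodset X S| * #|` Z| <= #|` prodset Z S| * #|` X|)%N].
Proof.
move=> E0.
have EP : E \in fpowerset E by rewrite fpowersetE.
pose F (X : fpowerset E) : rat := #|` prodset (val X) S|%:R / #|` val X|%:R.
case: (@arg_minP _ _ _ [` EP] (fun X : fpowerset E => val X != fset0) F E0) => -[X XE] /= X0 Xmin.
exists X; move: (XE); rewrite fpowersetE => XE'; split=> //.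
  have := Xmin [` EP] E0; rewrite /F /=.
  by rewrite ler_pdivrMr ?ltr0n ?cardfs_gt0 // mulrAC ler_pdivlMr
    ?ltr0n ?cardfs_gt0 // -!natrM ler_nat.
move=> Z ZX; have [->|Z0] := eqVneq Z fset0; first by rewrite cardfs0 muln0.
have ZE : Z \in fpowerset E by rewrite fpowersetE (fsubset_trans ZX).
have := Xmin [` ZE] Z0; rewrite /F /=.
by rewrite ler_pdivrMr ?ltr0n ?cardfs_gt0 // mulrAC ler_pdivlMr
    ?ltr0n ?cardfs_gt0 // -!natrM ler_nat.
Qed.

(** Ruzsa's triangle inequality. Fix a representation [q = y / z] of each quotient; then [(q, x)] is
    sent injectively to [(x * y, x * z)], whose quotient recovers [q], then [z] and [x]. *)
Lemma card_quotset_ruzsa X Y Z : 0 \notin X ->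
  (#|` quotset Y Z| * #|` X| <= #|` prodset X Y| * #|` prodset X Z|)%N.
Proof.
move=> X0.
have /choice[g gP] (q : R) : exists yz : R * R, q \in quotset Y Z ->
    [/\ yz.1 \in Y, yz.2 \in Z, yz.2 != 0 & q = yz.1 / yz.2].
  have [/quotsetP[y [z [yY zZ z0 ->]]]|_] := boolP (q \in quotset Y Z).
    by exists (y, z).
  by exists (0, 0).
rewrite !cardfE -!card_prod.
have h1 (p : quotset Y Z * X) : val p.2 * (g (val p.1)).1 \in prodset X Y.
  have [? ? _ _] := gP _ (valP p.1); apply/prodsetP.
  by exists (val p.2), (g (val p.1)).1; split=> //; exact: valP.
have h2 (p : quotset Y Z * X) : val p.2 * (g (val p.1)).2 \in prodset X Z.
  have [? ? _ _] := gP _ (valP p.1); apply/prodsetP.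
  by exists (val p.2), (g (val p.1)).2; split=> //; exact: valP.
apply: (@leq_card _ _ (fun p => ([` h1 p], [` h2 p]))) => -[q x] [q' x'] [/= e1 e2].
have [_ _ g0 qE] := gP _ (valP q); have [_ _ g0' qE'] := gP _ (valP q').
have nX (y : X) : val y != 0 by apply: contraNneq X0 => <-; exact: valP.
have qq' : q = q'.
  have e (u : X) (y z : R) : y / z = (val u * y) / (val u * z).
    by rewrite -mulf_div divff // mul1r.
  by apply: val_inj; rewrite qE qE' (e x) [RHS](e x') /= e1 e2.
by congr pair => //; apply/val_inj/(mulIf g0); rewrite /= e2 qq'.
Qed.
End ProductSets.

Lemma prodsetA (R : realType) (X Y Z : {fset R}) :
  prodset X (prodset Y Z) = prodset (prodset X Y) Z.
Proof.
apply/fsetP => w; apply/prodsetP/prodsetP.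
  move=> [x [_ [xX /prodsetP[y [z [yY zZ ->]]] ->]]].
  by exists (x * y), z; split=> //; [apply/prodsetP; exists x, y|rewrite mulrA].
move=> [_ [z [/prodsetP[x [y [xX yY ->]]] zZ ->]]].
by exists x, (y * z); split=> //; [apply/prodsetP; exists y, z|rewrite mulrA].
Qed.

(** For the minimizing [X], Ruzsa's inequality gives [#|SS/S| #|X| <= #|XSS| #|XS|] and Petridis'
    lemma gives [#|XSS| #|X| <= #|XS| ^ 2]. Then [#|XS| / #|X| <= #|ES| / #|E|] and [#|X| <= #|E|]
    eliminate [X]. *)
Lemma card_quotset_prodset (R : realType) (E S : {fset R}) :
  E != fset0 -> 0 \notin E -> 0 \notin S ->
  (#|` quotset (prodset S S) S| * #|` E| ^ 2 <= #|` prodset E S| ^ 3)%N.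
Proof.
move=> E0 nE nS; have [X [XE X0 h1 Xmin]] := exists_min_prodset_ratio S E0.
have h2 := card_prodset_petridis nS Xmin.
have nX : 0 \notin X by apply: contra nE; exact: (fsubsetP XE).
have := card_quotset_ruzsa (prodset S S) S nX; rewrite prodsetA.
have := fsubset_leq_card XE; move: E0 X0; rewrite -!cardfs_gt0.
move: h1 h2; move: #|` quotset _ _| #|` prodset (prodset X S) S| #|` prodset X S|
  #|` prodset E S| #|` E| #|` X| => q c a b e x h1 h2 e0 x0 xe h3.
have h4 : (q * x ^ 2 <= a ^ 3)%N.
  rewrite -mulnn mulnA (leq_trans (leq_mul h3 (leqnn x))) // mulnAC.
  by rewrite (leq_trans (leq_mul h2 (leqnn a))) // !expnS expn0 muln1 mulnA.
have h5 : (q * e ^ 3 * x ^ 2 <= b ^ 3 * x * x ^ 2)%N.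
  rewrite mulnAC (leq_trans (leq_mul h4 (leqnn _))) // -mulnA -expnS -!expnMn.
  by rewrite leq_exp2r.
move: h5; rewrite leq_pmul2r ?expn_gt0 ?x0 // => h5.
rewrite -(leq_pmul2r e0) -mulnA -expnSr (leq_trans h5) //.
by rewrite leq_mul2l xe orbT.
Qed.

(* For [u, v] in [S], the line [X / u + Y / v = 1] contains the points
   [(x u, (1 - x) v)], and both [x] and [1 - x] are in [ratios A]. *)
Lemma card_prodset_ratios (R : realType) (A S : {fset R}) :
  (3 < #|` A|)%N -> 0 \notin S ->
  (#|` ratios A| ^ 3 * #|` S| ^ 2 <= 36 * #|` prodset (ratios A) S| ^ 4)%N.
Proof.
move=> A3 nS; set W := prodset _ _.
(* Slope [- v / u] and intercept [v]. *)
pose l (uv : S * S) : R * R := (- (val uv.2 / val uv.1), val uv.2).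
have S0 (u : S) : val u != 0 by apply: contraNneq nS => <-; exact: valP.
have rich uv : (#|` ratios A| <= #|line_pts W (l uv)|)%N.
  have h1 (x : ratios A) : val x * val uv.1 \in W.
    by apply/prodsetP; exists (val x), (val uv.1); split=> //; exact: valP.
  have h2 (x : ratios A) : (1 - val x) * val uv.2 \in W.
    apply/prodsetP; exists (1 - val x), (val uv.2).
    by split=> //; [apply: ratios_subr1|]; exact: valP.
  pose g x := ([` h1 x], [` h2 x]).
  have ginj : injective g.
    by move=> x y [/(mulIf (S0 _)) /val_inj].
  rewrite cardfE -cardsT -(finset.card_imset _ ginj).
  apply/subset_leq_card/fintype.subsetP => _ /finset.imsetP[x _ ->].
  by rewrite inE /=; apply/eqP; field; exact: S0.
have linj : injective l.
  move=> [u v] [u' v'] [/= /eqP + /val_inj e]; subst v'.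
  by rewrite eqr_opp => /eqP/(mulfI (S0 v))/invr_inj/val_inj ->.
have := @rich_lines _ W _ predT l #|` ratios A| (card_ratios_gt1 A3).
move=> /(_ (fun _ _ _ _ => @linj _ _)) h.
apply: leq_trans (h _ _) => // [|[u v] _]; last first.
  by rewrite oppr_eq0 mulf_neq0 // invr_neq0.
rewrite expnS -mulnA leq_mul2l; apply/orP; right.
apply: (@leq_trans (\sum_(uv : S * S) #|` ratios A| ^ 2)); last first.
  by apply: leq_sum => uv _; rewrite leq_exp2r.
by rewrite sum_nat_const (card_prod S S) -cardfE mulnn mulnC.
Qed.

(** * Combination of the incidence and product-set bounds *)

Lemma card_ratios_prodset (R : realType) (A E S : {fset R}) :
  (3 < #|` A|)%N -> E != fset0 -> 0 \notin E -> 0 \notin S -> #|` S| = #|` E| ->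
  (forall x s, x \in ratios A -> s \in S -> x * s \in quotset (prodset S S) S) ->
  (#|` ratios A| ^ 3 * #|` E| ^ 10 <= 36 * #|` prodset E S| ^ 12)%N.
Proof.
move=> A3 E0 nE nS SE sub.
have h1 := card_prodset_ratios A3 nS; have h2 := card_quotset_prodset E0 nE nS.
have h3 : (#|` prodset (ratios A) S| <= #|` quotset (prodset S S) S|)%N.
  by apply/fsubset_leq_card/fsubsetP => _ /prodsetP[x [s [xA sS ->]]]; exact: sub.
rewrite -[10%N]/(2 + 2 * 4)%N expnD mulnA -SE.
rewrite (leq_trans (leq_mul h1 (leqnn _))) // -mulnA leq_mul2l /= SE expnM -expnMn.
by rewrite -[12%N]/(3 * 4)%N [leqRHS]expnM leq_exp2r // (leq_trans _ h2) // leq_mul2r h3 orbT.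
Qed.

(** * Logarithmic bounds and the final estimate *)

Lemma harmonic_le_ln (R : realType) (n : nat) :
  \sum_(1 <= j < n.+2) j%:R^-1 <= 1 + ln n.+1%:R :> R.
Proof.
elim: n => [|n IH]; first by rewrite big_nat1 invr1 ln1 addr0.
rewrite big_nat_recr //= (le_trans (lerD IH (lexx _))) // -addrA lerD2l.
have n1 : (0 : R) < n.+1%:R by rewrite ltr0n.
have n2 : (0 : R) < n.+2%:R by rewrite ltr0n.
(* The increment of [ln] is [- ln (1 - 1 / (n + 2))], which is at least [1 / (n + 2)]. *)
have -> : n.+1%:R = n.+2%:R * (1 - n.+2%:R^-1) :> R.
  by rewrite mulrBr mulr1 divff ?gt_eqF // -(natr1 n.+1) addrK.
have h : 0 < 1 - n.+2%:R^-1 :> R.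
  by rewrite subr_gt0 invf_lt1 // ltr1n.
rewrite lnM ?posrE //.
have := @le_ln1Dx R (- n.+2%:R^-1); rewrite ltrN2 invf_lt1 // ltr1n => /(_ isT).
by rewrite -addrA gerDl -lerBrDr sub0r.
Qed.

Lemma log2_ge1 (R : realType) (n : nat) : (1 < n)%N -> 1 <= log2 (n%:R : R).
Proof.
move=> n1; have l2 : 0 < ln (2 : R) by rewrite ln_gt0 // ltr1n.
by rewrite /log2 ler_pdivlMr // mul1r ler_ln ?posrE ?ltr0n ?ler_nat //; lia.
Qed.

Lemma harmonic_le_log2 (R : realType) (n : nat) : (1 < n)%N ->
  \sum_(1 <= j < n.+1) j%:R^-1 <= 2 * log2 (n%:R : R).
Proof.
move=> n1; have := log2_ge1 R n1; case: n n1 => // n n1 L1.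
apply: le_trans (harmonic_le_ln R n) _.
have l2 : 0 < ln (2 : R) by rewrite ln_gt0 // ltr1n.
have : ln n.+1%:R <= log2 n.+1%:R :> R.
  rewrite /log2 ler_pdivlMr // ler_piMr // ?ln_ge0 ?ler1n //.
  by rewrite -[2]/(1 + 1); apply: le_ln1Dx; lra.
lra.
Qed.

(** Here [d], [e], [r], [m], [N] stand for the sizes of [A - A], [E], the ratio set, [ES] and [A].
    Multiplying by [N ^+ 6] brings in the cube of the lower bound on [r]; then [m ^+ 12] contributes
    [N ^+ 24]. *)
Lemma combine_bounds (R : realFieldType) (a b c d e m r K N L : R) :
  0 <= a -> 0 <= b -> 0 <= c -> 0 <= d -> 0 <= e -> 0 <= m -> 0 <= r -> 0 <= K -> 0 < N -> 0 <= L ->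
  d <= a * e -> N ^+ 2 <= b * r * L -> m <= K * N ^+ 2 ->
  r ^+ 3 * e ^+ 10 <= c * m ^+ 12 ->
  d ^+ 10 <= a ^+ 10 * b ^+ 3 * c * K ^+ 12 * N ^+ 18 * L ^+ 3.
Proof.
move=> a0 b0 c0 d0 e0 m0 r0 K0 N0 L0 DE hr MK hM.
rewrite -(ler_pM2r (exprn_gt0 6 N0)).
apply: (@le_trans _ _ ((a * e) ^+ 10 * (b * r * L) ^+ 3)).
  apply: ler_pM; rewrite ?exprn_ge0 ?(ltW N0) //.
    by rewrite lerXn2r ?nnegrE ?mulr_ge0.
  by rewrite (exprM N 2 3) lerXn2r ?nnegrE ?mulr_ge0 ?exprn_ge0 ?(ltW N0).
apply: (@le_trans _ _ (a ^+ 10 * b ^+ 3 * L ^+ 3 * (c * (K * N ^+ 2) ^+ 12))).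
  rewrite [leLHS](_ : _ = a ^+ 10 * b ^+ 3 * L ^+ 3 * (r ^+ 3 * e ^+ 10)).
    rewrite ler_wpM2l ?mulr_ge0 ?exprn_ge0 // (le_trans hM) // ler_wpM2l //.
    by rewrite lerXn2r ?nnegrE ?mulr_ge0 ?exprn_ge0 ?(ltW N0).
  by ring.
rewrite le_eqVlt; apply/orP; left; apply/eqP; ring.
Qed.

Lemma card_diffset_pow10 (R : realType) (K : R) (A : {fset R}) :
  (3 < #|` A|)%N -> 0 < K ->
  (#|` quotset (diffset A A) (diffset A A)|%:R <= K * #|` A|%:R ^+ 2 \/
   #|` prodset (diffset A A) (diffset A A)|%:R <= K * #|` A|%:R ^+ 2) ->
  #|` diffset A A|%:R ^+ 10 <=
    2 ^+ 10 * 1152 ^+ 3 * 36 * K ^+ 12 * #|` A|%:R ^+ 18 * log2 (#|` A|%:R : R) ^+ 3.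
Proof.
move=> A3 K0 hyp; set D := diffset A A in hyp *.
have A1 : (1 < #|` A|)%N by lia.
have DP x y : x \in A -> y \in A -> x - y \in D.
  by move=> xA yA; apply/imfset2P; exists x => //; exists y.
pose E := D `\ 0.
have nE : 0 \notin E by rewrite !inE eqxx.
have EP x : x \in E = (x != 0) && (x \in D) by rewrite !inE.
have EV : 0 \notin [fset x^-1 | x in E].
  apply/imfsetP => -[x /= xE /eqP]; rewrite eq_sym invr_eq0 => /eqP x0.
  by rewrite x0 (negPf nE) in xE.
have ratE x : x \in ratios A -> exists d e, [/\ d \in E, e \in E & x = d / e].
  case/ratiosP => a [b [c [[aA bA cA] [ab ac bc] ->]]].
  by exists (c - a), (b - a); rewrite !EP !subr_eq0 !DP // ![_ == a]eq_sym ab ac.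
have E0 : E != fset0.
  have [x xR] : exists x, x \in ratios A.
    have := card_ratios_gt1 A3.
    by case: (fset_0Vmem (ratios A)) => [->|[x ?]]; [rewrite cardfs0|exists x].
  by have [d [e [dE _ _]]] := ratE _ xR; apply/fset0Pn; exists d.
have DE : (#|` D| <= 2 * #|` E|)%N.
  have := cardfsD1 0 D; rewrite -/E; move: E0; rewrite -cardfs_gt0.
  by case: (_ \in D) => e0 ->; rewrite mul2n -addnn leq_add2r.
(* [M] is the size of [ES], with [S] the inverses of [E] under the quotient hypothesis and [S = E]
   under the product hypothesis. *)
have [M MK hM] : exists2 M : nat, M%:R <= K * #|` A|%:R ^+ 2 &
    (#|` ratios A| ^ 3 * #|` E| ^ 10 <= 36 * M ^ 12)%N.
  case: hyp => hyp.
    pose S := [fset x^-1 | x in E].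
    exists #|` prodset E S|.
      apply: le_trans hyp; rewrite ler_nat; apply/fsubset_leq_card/fsubsetP => z.
      case/prodsetP => x [_ [xE /imfsetP[y /= yE ->] ->]]; apply/quotsetP.
      by move: xE yE; rewrite !EP => /andP[_ xD] /andP[y0 yD]; exists x, y.
    apply: card_ratios_prodset => //; first exact: (card_imfset _ _ invr_inj).
    move=> _ _ /ratE[d [e [dE eE ->]]] /imfsetP[s /= sE ->]; apply/quotsetP.
    have VS y : y \in E -> y^-1 \in S by move=> yE; apply/imfsetP; exists y.
    (* With inverses, [(d / e) * s^-1] is [(e^-1 * s^-1) / d^-1], so [d] and [e] exchange roles. *)
    exists (e^-1 * s^-1), d^-1; split; rewrite ?VS //.
    - by apply/prodsetP; exists e^-1, s^-1; split; rewrite ?VS.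
    - by rewrite invr_eq0; move: dE; rewrite EP => /andP[].
    - by rewrite invrK [RHS]mulrC mulrA.
  exists #|` prodset E E|.
    apply: le_trans hyp; rewrite ler_nat; apply/fsubset_leq_card/fsubsetP => z.
    case/prodsetP => x [y [xE yE ->]]; apply/prodsetP.
    by move: xE yE; rewrite !EP => /andP[_ xD] /andP[_ yD]; exists x, y.
  apply: card_ratios_prodset => //.
  move=> _ s /ratE[d [e [dE eE ->]]] sE; apply/quotsetP.
  exists (d * s), e; split=> //; first by apply/prodsetP; exists d, s.
    by move: eE; rewrite EP => /andP[].
  by rewrite mulrAC.
have L1 := log2_ge1 R A1; set L := log2 _ in L1 *.
have hr : #|` A|%:R ^+ 2 <= 1152 * #|` ratios A|%:R * L :> R.
  apply: le_trans (card_ratios A3) _.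
  rewrite [leRHS](_ : _ = 576 * #|` ratios A|%:R * (2 * L)); last by ring.
  apply: ler_wpM2l; last exact: harmonic_le_log2.
  by apply: mulr_ge0; exact: ler0n.
have N0 : 0 < #|` A|%:R :> R by rewrite ltr0n (ltn_trans _ A1).
have {}hM : #|` ratios A|%:R ^+ 3 * #|` E|%:R ^+ 10 <= 36 * M%:R ^+ 12 :> R.
  by rewrite -!natrX -!natrM ler_nat.
have {}DE : #|` D|%:R <= 2 * #|` E|%:R :> R by rewrite -natrM ler_nat.
exact: (combine_bounds (ler0n R 2) (ler0n R 1152) (ler0n R 36) (ler0n _ _) (ler0n _ _)
  (ler0n _ _) (ler0n _ _) (ltW K0) N0 (le_trans ler01 L1) DE hr MK hM).
Qed.

Theorem corollary4 (R : realType) (K : R) (hK : 0 < K) :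
  exists C : R, 0 < C /\
    forall A : {fset R}, (2 <= #|` A|)%N ->
      (#|` quotset (diffset A A) (diffset A A)|%:R <= K * #|` A|%:R ^+ 2 \/
       #|` prodset (diffset A A) (diffset A A)|%:R <= K * #|` A|%:R ^+ 2) ->
      #|` diffset A A|%:R <=
        C * #|` A|%:R `^ (2 - 1 / 5) * log2 (#|` A|%:R : R) `^ (3 / 10).
Proof.
have [C0 C0_ge0 bound] : exists2 C0 : R, 0 <= C0 & forall A : {fset R},
    (3 < #|` A|)%N ->
    (#|` quotset (diffset A A) (diffset A A)|%:R <= K * #|` A|%:R ^+ 2 \/
     #|` prodset (diffset A A) (diffset A A)|%:R <= K * #|` A|%:R ^+ 2) ->
    #|` diffset A A|%:R ^+ 10 <= C0 * #|` A|%:R ^+ 18 * log2 (#|` A|%:R : R) ^+ 3.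
  exists (2 ^+ 10 * 1152 ^+ 3 * 36 * K ^+ 12).
    by rewrite !mulr_ge0 ?exprn_ge0 ?ler0n // ltW.
  by move=> A A3; exact: card_diffset_pow10.
exists (9 + C0); split=> [|A A2 hyp]; first by rewrite ltr_wpDr.
have L1 := log2_ge1 R A2.
have N1 : 1 <= #|` A|%:R :> R by rewrite ler1n (ltn_trans _ A2).
set t := _ `^ (2 - 1 / 5); set s := _ `^ (3 / 10).
have pow_ge1 (x p : R) : 1 <= x -> 0 <= p -> 1 <= x `^ p.
  by move=> x1 p0; rewrite -(powRr0 x) ler_powR.
have t1 : 1 <= t by apply: pow_ge1 => //; lra.
have s1 : 1 <= s by apply: pow_ge1 => //; lra.
have pow10 (x p : R) n : p * 10%:R = n%:R -> 0 <= x -> (x `^ p) ^+ 10 = x ^+ n.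
  by move=> pn x0; rewrite -powR_mulrn ?powR_ge0 // -powRrM pn powR_mulrn.
have [A3|A3] := leqP #|` A| 3.
  have cD : (#|` diffset A A| <= 3 * 3)%N.
    apply: leq_trans (leq_mul A3 A3); rewrite !cardfE -(card_prod A A).
    have h (p : A * A) : val p.1 - val p.2 \in diffset A A.
      by apply/imfset2P; exists (val p.1); [|exists (val p.2)] => //; exact: valP.
    apply: leq_trans (fintype.leq_image_card (fun p => [` h p]) predT).
    apply/subset_leq_card/fintype.subsetP => -[d dD] _.
    case/imfset2P: (dD) => x xA [y yA e].
    by apply/fintype.imageP; exists ([` xA], [` yA]) => //; apply: val_inj.
  apply: (@le_trans _ _ 9); first by rewrite ler_nat.
  rewrite -mulrA (le_trans _ (ler_peMr _ (mulr_ege1 t1 s1))) ?lerDl //; lra.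
have C1 : 1 <= 9 + C0 by lra.
have x0 : 0 <= (9 + C0) * t * s by rewrite !mulr_ge0 //; lra.
(* Tenth powers turn the exponents [2 - 1 / 5] and [3 / 10] into 18 and 3; as [9 + C0 >= 1], its
   tenth power still dominates [C0]. *)
rewrite -(@ler_pXn2r _ 10) ?nnegrE // ?(le_trans (bound _ A3 hyp)) //.
rewrite [leRHS]exprMn [((_ + _) * t) ^+ _]exprMn (pow10 _ _ 18) ?(pow10 _ _ 3); try lra.
rewrite ler_wpM2r ?exprn_ge0 ?(le_trans ler01) //.
rewrite ler_wpM2r ?exprn_ge0 //.
by rewrite (@le_trans _ _ (9 + C0)) //; [lra|rewrite ler_eXnr].
Qed.
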